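(* The hyperspace monad $\mathbb H=(\exp,s,u)$ is a submonad of the idempotent probability measure monad $\mathbb I=(I,\eta,\zeta)$ on the category of compact Hausdorff spaces and continuous maps.
   Context: For a compact Hausdorff space $X$, $C(X)$ is the Banach space of continuous real-valued functions on $X$ with the sup-norm; $c_X\in C(X)$ is the constant function with value $c\in\mathbb R$; $c\odot\varphi=c_X+\varphi$ for $c\in\mathbb R$, $\varphi\in C(X)$, and $\varphi\oplus\psi=\max\{\varphi,\psi\}$ (pointwise); for real numbers $a\odot b=a+b$, $a\oplus b=\max\{a,b\}$. An idempotent probability measure on $X$ is a functional $\mu\colon C(X)\to\mathbb R$ such that $\mu(c_X)=c$, $\mu(c\odot\varphi)=c\odot\mu(\varphi)$ and $\mu(\varphi\oplus\psi)=\mu(\varphi)\oplus\mu(\psi)$ for all $c\in\mathbb R$, $\varphi,\psi\in C(X)$. $I(X)$ is the set of all idempotent probability measures on $X$ with the weak* topology, whose base consists of the sets $\{\nu\in I(X)\mid |\mu(\varphi_i)-\nu(\varphi_i)|<\varepsilon,\ i=1,\dots,n\}$, where $\mu\in I(X)$, $\varphi_1,\dots,\varphi_n\in C(X)$, $\varepsilon>0$; the space $I(X)$ is compact Hausdorff. For a continuous map $f\colon X\to Y$ of compact Hausdorff spaces, $I(f)\colon I(X)\to I(Y)$ is defined by $I(f)(\mu)(\varphi)=\mu(\varphi\circ f)$, $\varphi\in C(Y)$. The monad $\mathbb I=(I,\eta,\zeta)$: $\eta_X(x)=\delta_x$, where $\delta_x(\varphi)=\varphi(x)$; and $\zeta_X\colon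 I^2(X)\to I(X)$ is $\zeta_X(M)(\varphi)=M(\bar\varphi)$, where $\bar\varphi\colon I(X)\to\mathbb R$, $\bar\varphi(\mu)=\mu(\varphi)$. The hyperspace monad $\mathbb H=(\exp,s,u)$: $\exp X$ is the set of all nonempty closed subsets of $X$ with the Vietoris topology, whose base consists of the sets $\langle U_1,\dots,U_n\rangle=\{A\in\exp X\mid A\subset\bigcup_{i=1}^nU_i,\ A\cap U_i\ne\emptyset,\ i=1,\dots,n\}$ with $U_1,\dots,U_n$ open in $X$; for continuous $f\colon X\to Y$, $\exp f(A)=f(A)$; $s_X(x)=\{x\}$; $u_X(\mathcal A)=\bigcup\mathcal A$ for $\mathcal A\in\exp^2X=\exp(\exp X)$. A natural transformation $\psi\colon T\to T'$ is a morphism from a monad $(T,\eta,\mu)$ to a monad $(T',\eta',\mu')$ (on the same category) if $\psi\circ\eta=\eta'$ and $\psi\circ\mu=\mu'\circ\psi T'\circ T\psi$. The monad $(T,\eta,\mu)$ is a submonad of $(T',\eta',\mu')$ if there is a monad morphism $\psi\colon T\to T'$ all of whose components are monomorphisms. *)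

(* Defs.v *)
From HB Require Import structures.
From mathcomp Require Import all_boot all_order all_algebra.
From mathcomp Require Import all_classical all_reals topology normedtype.
Set Implicit Arguments.
Unset Strict Implicit.
Unset Printing Implicit Defensive.
Import Order.TTheory GRing.Theory Num.Theory.
Import numFieldNormedType.Exports.
Local Open Scope classical_set_scope.
Local Open Scope ring_scope.

Record category := Category {
  obj :> Type ;
  hom : obj -> obj -> Type ;
  idc : forall a, hom a a ;
  compc : forall a b c, hom b c -> hom a b -> hom a c ;
  compc1 : forall a b (f : hom a b), compc f (idc a) = f ;
  comp1c : forall a b (f : hom a b), compc (idc b) f = f ;
  compcA : forall a b c d (h : hom c d) (g : hom b c) (f : hom a b),
    compc h (compc g f) = compc (compc h g) f }.
Arguments hom {_} _ _.
Arguments idc {_} _.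
Arguments compc {_ _ _ _} _ _.

Notation "g '\oc' f" := (compc g f) (at level 50, left associativity).

Definition mono (C : category) (a b : C) (f : hom a b) : Prop :=
  forall (c : C) (g h : hom c a), f \oc g = f \oc h -> g = h.

Record endofunctor (C : category) := Endofunctor {
  fobj :> C -> C ;
  fmap : forall a b, hom a b -> hom (fobj a) (fobj b) ;
  fmap1 : forall a, fmap (idc a) = idc (fobj a) ;
  fmapM : forall a b c (g : hom b c) (f : hom a b),
    fmap (g \oc f) = fmap g \oc fmap f }.
Arguments fmap {C} e {a b} _ : rename.

Definition fid (C : category) : endofunctor C :=
  @Endofunctor C (fun a => a) (fun a b f => f)
    (fun=> erefl) (fun _ _ _ _ _ => erefl).

Section fcomp.
Variables (C : category) (F G : endofunctor C).

Lemma fcomp1 a : fmap F (fmap G (idc a)) = idc (F (G a)).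
Proof. by rewrite !fmap1. Qed.

Lemma fcompM a b c (g : hom b c) (f : hom a b) :
  fmap F (fmap G (g \oc f)) = fmap F (fmap G g) \oc fmap F (fmap G f).
Proof. by rewrite !fmapM. Qed.

Definition fcomp : endofunctor C :=
  @Endofunctor C (fun a => F (G a)) (fun a b f => fmap F (fmap G f))
    fcomp1 fcompM.
End fcomp.

Record nattrans (C : category) (F G : endofunctor C) := NatTrans {
  component :> forall a, hom (F a) (G a) ;
  naturality : forall a b (f : hom a b),
    fmap G f \oc component a = component b \oc fmap F f }.

Record monad (C : category) := Monad {
  mfun :> endofunctor C ;
  munit : nattrans (fid C) mfun ;
  mmult : nattrans (fcomp mfun mfun) mfun ;
  mmultA : forall a, mmult a \oc fmap mfun (mmult a) = mmult a \oc mmult (mfun a) ;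
  mmult_unitl : forall a, mmult a \oc munit (mfun a) = idc (mfun a) ;
  mmult_unitr : forall a, mmult a \oc fmap mfun (munit a) = idc (mfun a) }.
Arguments munit {C}.
Arguments mmult {C}.

Definition monad_morphism (C : category) (S T : monad C) (psi : nattrans S T) :=
  (forall a, psi a \oc munit S a = munit T a) /\
  (forall a, psi a \oc mmult S a = mmult T a \oc psi (T a) \oc fmap S (psi a)).

Definition submonad (C : category) (S T : monad C) : Prop :=
  exists psi : nattrans S T, monad_morphism psi /\ forall a, mono (psi a).

(* The empty space is an object; both functors below send it to itself. *)
Record compact_hausdorff := CompactHausdorff {
  chspace :> topologicalType ;
  chspace_compact : compact [set: chspace] ;
  chspace_hausdorff : hausdorff_space chspace }.

Section continuous_composition.

Definition cts_id (X : topologicalType) : continuousType X X := idfun.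

Definition cts_comp (X Y Z : topologicalType)
  (g : continuousType Y Z) (f : continuousType X Y) : continuousType X Z :=
  g \o f.

Lemma cts_compf1 (X Y : topologicalType) (f : continuousType X Y) :
  cts_comp f (cts_id X) = f.
Proof. exact/continuousEP. Qed.

Lemma cts_comp1f (X Y : topologicalType) (f : continuousType X Y) :
  cts_comp (cts_id Y) f = f.
Proof. exact/continuousEP. Qed.

Lemma cts_compA (X Y Z W : topologicalType) (h : continuousType Z W)
    (g : continuousType Y Z) (f : continuousType X Y) :
  cts_comp h (cts_comp g f) = cts_comp (cts_comp h g) f.
Proof. exact/continuousEP. Qed.

End continuous_composition.

Definition CompHaus : category :=
  @Category compact_hausdorff (fun X Y => continuousType X Y)
    cts_id cts_comp cts_compf1 cts_comp1f cts_compA.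

Lemma ctsP (X Y : topologicalType) (f : continuousType X Y) : continuous f.
Proof. exact: cts_fun. Qed.

Definition mkcont (X Y : topologicalType) (f : X -> Y) (cf : continuous f) :
  continuousType X Y := mkcts cf.

Section continuous_functions.
Variables (R : realType) (X : topologicalType).
Implicit Types phi psi : continuousType X R.

Definition cts_const (c : R) : continuousType X R := cst c.

Lemma cts_odot_subproof (c : R) phi : continuous (fun x => c + phi x).
Proof. by move=> x; exact: (cvgD (cvg_cst c) (@ctsP _ _ phi x)). Qed.

Definition cts_odot (c : R) phi := mkcont (@cts_odot_subproof c phi).

Lemma cts_oplus_subproof phi psi :
  continuous (fun x => Order.max (phi x) (psi x)).
Proof. by move=> x; apply: continuous_max; exact: ctsP. Qed.

Definition cts_oplus phi psi := mkcont (@cts_oplus_subproof phi psi).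

End continuous_functions.

Section idempotent_measures.
Variables (R : realType) (X : topologicalType).
Implicit Types phi psi : continuousType X R.

(* C(X) is the type continuousType X R; its norm plays no role in what follows. *)
Record idempotent_measure := IdempotentMeasure {
  imfun :> continuousType X R -> R ;
  im_const : forall c, imfun (cts_const X c) = c ;
  im_odot : forall c phi, imfun (cts_odot c phi) = c + imfun phi ;
  im_oplus : forall phi psi,
    imfun (cts_oplus phi psi) = Order.max (imfun phi) (imfun psi) }.

HB.instance Definition _ := gen_eqMixin idempotent_measure.
HB.instance Definition _ := gen_choiceMixin idempotent_measure.

Lemma imP (mu nu : idempotent_measure) : mu =1 nu -> mu = nu.
Proof.
case: mu nu => [m m1 m2 m3] [n n1 n2 n3] /= /funext mn; subst n.
by congr IdempotentMeasure; exact: Prop_irrelevance.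
Qed.

Definition im_ball (mu : idempotent_measure) (s : seq (continuousType X R))
    (e : R) : set idempotent_measure :=
  [set nu : idempotent_measure |
    forall phi, phi \in s -> `|mu phi - nu phi| < e].

Definition im_base : set (set idempotent_measure) :=
  [set U | exists mu s e, 0 < e /\ U = im_ball mu s e].

Lemma im_base_cover : \bigcup_(U in im_base) U = setT.
Proof.
apply/seteqP; split=> // mu _.
by exists (im_ball mu [::] 1) => //; exists mu, [::], 1.
Qed.

Lemma seq_gap (T : eqType) (s : seq T) (g : T -> R) :
  (forall x, x \in s -> 0 < g x) ->
  exists2 d : R, 0 < d & forall x, x \in s -> d <= g x.
Proof.
elim: s => [|a s IH] gs; first by exists 1.
have [|d d0 ds] := IH; first by move=> x xs; apply: gs; rewrite inE xs orbT.
exists (Order.min (g a) d); first by rewrite lt_min d0 gs// inE eqxx.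
move=> x; rewrite inE => /orP[/eqP->|/ds dx]; rewrite ge_min ?lexx//.
by rewrite dx orbT.
Qed.

Lemma im_ball_shrink (mu nu : idempotent_measure) s e :
  im_ball mu s e nu ->
  exists2 d : R, 0 < d & im_ball nu s d `<=` im_ball mu s e.
Proof.
move=> munu.
have [|d d0 ds] := @seq_gap _ s (fun phi => e - `|mu phi - nu phi|).
  by move=> phi /munu; rewrite subr_gt0.
exists d => // la nula phi phis; have := nula _ phis.
move=> /lt_le_trans/(_ (ds _ phis)); rewrite ltrBrDl.
by apply: le_lt_trans; rewrite -[leLHS]/(`|_|) (ler_distD (nu phi)).
Qed.

Lemma im_base_join (U V : set idempotent_measure) mu :
  im_base U -> im_base V -> U mu -> V mu ->
  exists W, [/\ im_base W, W mu & W `<=` U `&` V].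
Proof.
move=> [m1 [s1 [e1 [_ ->]]]] [m2 [s2 [e2 [_ ->]]]].
move=> /im_ball_shrink[d1 d10 H1] /im_ball_shrink[d2 d20 H2].
exists (im_ball mu (s1 ++ s2) (Order.min d1 d2)); split.
- by exists mu, (s1 ++ s2), (Order.min d1 d2); rewrite lt_min d10 d20.
- by move=> phi _; rewrite subrr normr0 lt_min d10 d20.
- move=> nu munu; split; [apply: H1|apply: H2] => phi phis.
  + by have := munu phi; rewrite mem_cat phis lt_min => /(_ isT)/andP[].
  + by have := munu phi; rewrite mem_cat phis orbT lt_min => /(_ isT)/andP[].
Qed.

HB.instance Definition _ := @isBaseTopological.Build idempotent_measure
  (set idempotent_measure) im_base id im_base_cover im_base_join.

Lemma nbhs_im (mu : idempotent_measure) (A : set idempotent_measure) :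
  nbhs mu A <-> exists s e, 0 < e /\ im_ball mu s e `<=` A.
Proof.
split.
  rewrite nbhsE => -[B [[D' D'D DB]]] + BA; rewrite -DB => -[U D'U Umu].
  have [m [s [e [e0 UE]]]] := D'D _ D'U.
  have [d d0 dH] : exists2 d, 0 < d & im_ball mu s d `<=` im_ball m s e.
    by apply: im_ball_shrink; rewrite -UE.
  exists s, d; split => // nu /dH; rewrite -UE => Unu.
  by apply: BA; rewrite -DB; exists U.
move=> [s [e [e0 sA]]]; rewrite nbhsE; exists (im_ball mu s e) => //; split.
  exists [set im_ball mu s e]; last by rewrite bigcup_set1.
  by move=> _ ->; exists mu, s, e.
by move=> phi _; rewrite subrr normr0.
Qed.

Lemma im_cvg (F : set_system idempotent_measure) (mu : idempotent_measure) :
  Filter F ->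
  (forall phi, (fun nu : idempotent_measure => nu phi) @ F --> mu phi) ->
  F --> mu.
Proof.
move=> FF Fmu A /nbhs_im[s [e [e0 sA]]]; apply: filterS sA _.
elim: s => [|phi s IH]; first by apply: filterS filterT => nu _ phi.
have /cvgrPdist_lt/(_ e e0) /= Fphi := Fmu phi.
apply: filterS2 Fphi IH => nu nuphi nus psi; rewrite inE => /orP[/eqP->//|].
exact: nus.
Qed.

Lemma im_continuous (T : topologicalType) (f : T -> idempotent_measure) :
  (forall phi, continuous (fun t => f t phi)) -> continuous f.
Proof.
move=> cf t; apply: (im_cvg (@fmap_filter _ _ f _ (nbhs_filter t))) => phi.
exact: cf.
Qed.

Definition im_eval phi (mu : idempotent_measure) : R := mu phi.

Lemma im_eval_subproof phi : continuous (im_eval phi).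
Proof.
move=> mu; apply/(@cvgrPdist_lt _ _ _ _ (nbhs_filter mu)) => e e0; apply/nbhs_im.
by exists [:: phi], e; split => // nu /(_ phi); rewrite inE eqxx => /(_ isT).
Qed.

Definition im_bar phi : continuousType idempotent_measure R :=
  mkcont (@im_eval_subproof phi).

Lemma im_mono (mu : idempotent_measure) phi psi :
  (forall x, phi x <= psi x) -> mu phi <= mu psi.
Proof.
move=> le_phi_psi; suff -> : psi = cts_oplus phi psi by rewrite im_oplus le_max lexx.
by apply/continuousEP => x /=; rewrite /mkcts max_r.
Qed.

Lemma im_bounded phi (M : R) (mu : idempotent_measure) :
  (forall x, `|phi x| <= M) -> `|mu phi| <= M.
Proof.
move=> phiM; rewrite ler_norml; apply/andP; split.
  rewrite -[leLHS](im_const mu); apply: im_mono => x.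
  by have := phiM x; rewrite ler_norml => /andP[].
rewrite -[leRHS](im_const mu); apply: im_mono => x.
by have := phiM x; rewrite ler_norml => /andP[].
Qed.

Lemma im_hausdorff : hausdorff_space idempotent_measure.
Proof.
move=> mu nu munu; apply: imP => phi; apply: (@Rhausdorff R) => A B Amu Bnu.
have [la [Ala Bla]] := munu _ _ (im_eval_subproof Amu) (im_eval_subproof Bnu).
by exists (la phi).
Qed.

End idempotent_measures.

Lemma ultra_fmap (T U : Type) (f : T -> U) (F : set_system T) :
  UltraFilter F -> UltraFilter (f @ F).
Proof.
move=> UF; split; first exact: fmap_proper_filter.
move=> G PG FG; apply/seteqP; split => // A GA.
have [//|FnA] := in_ultra_setVsetC (f @^-1` A) UF.
have GnA : G (~` A) by exact: FG.
by have /filter_ex[x []] : G (A `&` ~` A) by exact: filterI.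
Qed.

Lemma cts_bounded (R : realType) (X : compact_hausdorff)
  (phi : continuousType X R) : exists M, forall x, `|phi x| <= M.
Proof.
have cphi : compact (phi @` setT).
  apply: continuous_compact (@chspace_compact X).
  exact/continuous_subspaceT/ctsP.
have [M [_ HM]] := compact_bounded cphi.
by exists (M + 1) => x; apply: (HM (M + 1)); [rewrite ltrDl|exists x].
Qed.

Section idempotent_measure_compact.
Variables (R : realType) (X : compact_hausdorff).

Lemma im_compact : compact [set: idempotent_measure R X].
Proof.
rewrite compact_ultra => F UF _.
have FF : ProperFilter F by exact: ultra_proper.
have /choice[L HL] : forall phi : continuousType X R, exists l : R,
    (fun nu : idempotent_measure R X => nu phi) @ F --> l.
  move=> phi; have [M HM] := cts_bounded phi.
  have := @segment_compact R (- M) M; rewrite compact_ultra.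
  move=> /(_ ((fun nu : idempotent_measure R X => nu phi) @ F)).
  case; first exact: ultra_fmap.
    apply: (@filterS _ F _ setT) filterT => nu _; rewrite /= in_itv /= -ler_norml.
    exact: im_bounded.
  by move=> l [_ Fl]; exists l.
have lim_unique (g : idempotent_measure R X -> R) (l l' : R) :
    g @ F --> l -> g @ F --> l' -> l = l'.
  by move=> gl gl'; exact: (cvg_unique (@Rhausdorff R) gl gl').
have Lc c : L (cts_const X c) = c.
  apply: lim_unique (HL _) _; under eq_fun do rewrite im_const; exact: cvg_cst.
have Lo c phi : L (cts_odot c phi) = c + L phi.
  apply: lim_unique (HL _) _; under eq_fun do rewrite im_odot.
  exact: cvgD (cvg_cst c) (HL phi).
have Lp phi psi : L (cts_oplus phi psi) = Order.max (L phi) (L psi).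
  apply: lim_unique (HL _) _; under eq_fun do rewrite im_oplus.
  apply: (@continuous2_cvg _ R R R F FF _ _ Order.max) (HL phi) (HL psi).
  exact: (@max_continuous _ R (L phi, L psi)).
exists (IdempotentMeasure Lc Lo Lp); split => //=.
exact: im_cvg.
Qed.

Definition im_space : compact_hausdorff :=
  CompactHausdorff im_compact (@im_hausdorff R X).

End idempotent_measure_compact.

Section idempotent_measure_map.
Variables (R : realType) (X Y : topologicalType) (f : continuousType X Y).
Variable mu : idempotent_measure R X.

Let nu (phi : continuousType Y R) : R := mu (cts_comp phi f).

Lemma im_map_const c : nu (cts_const Y c) = c.
Proof. by rewrite -[RHS](im_const mu); congr (mu _); exact/continuousEP. Qed.

Lemma im_map_odot c phi : nu (cts_odot c phi) = c + nu phi.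
Proof. by rewrite -im_odot; congr (mu _); exact/continuousEP. Qed.

Lemma im_map_oplus phi psi :
  nu (cts_oplus phi psi) = Order.max (nu phi) (nu psi).
Proof. by rewrite -im_oplus; congr (mu _); exact/continuousEP. Qed.

Definition im_map : idempotent_measure R Y :=
  IdempotentMeasure im_map_const im_map_odot im_map_oplus.

End idempotent_measure_map.

Section idempotent_measure_unit.
Variables (R : realType) (X : topologicalType) (x : X).

Let d (phi : continuousType X R) : R := phi x.

Lemma im_dirac_const c : d (cts_const X c) = c. Proof. by []. Qed.

Lemma im_dirac_odot c phi : d (cts_odot c phi) = c + d phi. Proof. by []. Qed.

Lemma im_dirac_oplus phi psi : d (cts_oplus phi psi) = Order.max (d phi) (d psi).
Proof. by []. Qed.

Definition im_dirac : idempotent_measure R X :=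
  IdempotentMeasure im_dirac_const im_dirac_odot im_dirac_oplus.

End idempotent_measure_unit.

Section idempotent_measure_mult.
Variables (R : realType) (X : topologicalType).
Variable M : idempotent_measure R (idempotent_measure R X).

Let m (phi : continuousType X R) : R := M (im_bar phi).

Lemma im_flatten_const c : m (cts_const X c) = c.
Proof.
rewrite -[RHS](im_const M); congr (M _); apply/continuousEP => mu.
exact: im_const.
Qed.

Lemma im_flatten_odot c phi : m (cts_odot c phi) = c + m phi.
Proof.
by rewrite -im_odot; congr (M _); apply/continuousEP => mu; exact: im_odot.
Qed.

Lemma im_flatten_oplus phi psi :
  m (cts_oplus phi psi) = Order.max (m phi) (m psi).
Proof.
by rewrite -im_oplus; congr (M _); apply/continuousEP => mu; exact: im_oplus.
Qed.

(* The image under zeta of a measure M on the space of measures. *)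
Definition im_flatten : idempotent_measure R X :=
  IdempotentMeasure im_flatten_const im_flatten_odot im_flatten_oplus.

End idempotent_measure_mult.

Section idempotent_measure_monad.
Variable R : realType.

Lemma im_map_continuous (X Y : topologicalType) (f : continuousType X Y) :
  continuous (@im_map R X Y f).
Proof.
apply: im_continuous => phi.
exact: (@im_eval_subproof R X (cts_comp phi f)).
Qed.

Definition im_fmap (X Y : CompHaus) (f : hom X Y) :
    hom (im_space R X : CompHaus) (im_space R Y) :=
  mkcont (@im_map_continuous X Y f).

Lemma im_fmap1 (X : CompHaus) : im_fmap (idc X) = idc (im_space R X : CompHaus).
Proof.
apply/continuousEP => mu; apply: imP => phi /=.
by congr (mu _); exact/continuousEP.
Qed.

Lemma im_fmapM (X Y Z : CompHaus) (g : hom Y Z) (f : hom X Y) :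
  im_fmap (g \oc f) = im_fmap g \oc im_fmap f.
Proof.
apply/continuousEP => mu; apply: imP => phi /=.
by congr (mu _); exact/continuousEP.
Qed.

Definition im_functor : endofunctor CompHaus :=
  @Endofunctor CompHaus (im_space R) im_fmap im_fmap1 im_fmapM.

Lemma im_dirac_continuous (X : topologicalType) : continuous (@im_dirac R X).
Proof. by apply: im_continuous => phi; exact: ctsP. Qed.

Definition im_unit_component (X : CompHaus) : hom X (im_functor X) :=
  mkcont (@im_dirac_continuous X).

Lemma im_unit_natural (X Y : CompHaus) (f : hom X Y) :
  fmap im_functor f \oc im_unit_component X = im_unit_component Y \oc f.
Proof. by apply/continuousEP => x; exact: imP. Qed.

Definition im_unit : nattrans (fid CompHaus) im_functor :=
  @NatTrans CompHaus (fid CompHaus) im_functor im_unit_component im_unit_natural.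

Lemma im_flatten_continuous (X : topologicalType) :
  continuous (@im_flatten R X).
Proof.
apply: im_continuous => phi.
exact: (@im_eval_subproof R _ (im_bar phi)).
Qed.

Definition im_mult_component (X : CompHaus) :
    hom (im_functor (im_functor X)) (im_functor X) :=
  mkcont (@im_flatten_continuous X).

Lemma im_mult_natural (X Y : CompHaus) (f : hom X Y) :
  fmap im_functor f \oc im_mult_component X =
  im_mult_component Y \oc fmap (fcomp im_functor im_functor) f.
Proof.
apply/continuousEP => M; apply: imP => phi /=.
by congr (M _); exact/continuousEP.
Qed.

Definition im_mult : nattrans (fcomp im_functor im_functor) im_functor :=
  @NatTrans CompHaus (fcomp im_functor im_functor) im_functor
    im_mult_component im_mult_natural.

Lemma im_multA (X : CompHaus) :
  im_mult X \oc fmap im_functor (im_mult X) = im_mult X \oc im_mult (im_functor X).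
Proof.
apply/continuousEP => M; apply: imP => phi /=.
by congr (M _); exact/continuousEP.
Qed.

Lemma im_mult_unitl (X : CompHaus) :
  im_mult X \oc im_unit (im_functor X) = idc (im_functor X).
Proof. by apply/continuousEP => mu; exact: imP. Qed.

Lemma im_mult_unitr (X : CompHaus) :
  im_mult X \oc fmap im_functor (im_unit X) = idc (im_functor X).
Proof.
apply/continuousEP => mu; apply: imP => phi /=.
by congr (mu _); exact/continuousEP.
Qed.

Definition idempotent_measure_monad : monad CompHaus :=
  @Monad CompHaus im_functor im_unit im_mult im_multA im_mult_unitl im_mult_unitr.

End idempotent_measure_monad.

Section hyperspace.
Variable X : topologicalType.

Record hyperspace := Hyperspace {
  hset :> set X ;
  hset_closed : closed hset ;
  hset_nonempty : hset !=set0 }.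

HB.instance Definition _ := gen_eqMixin hyperspace.
HB.instance Definition _ := gen_choiceMixin hyperspace.

Lemma hyperP (A B : hyperspace) : A = B :> set X -> A = B.
Proof.
case: A B => [A a1 a2] [B b1 b2] /= AB; subst B.
by congr Hyperspace; exact: Prop_irrelevance.
Qed.

(* <U_1, ..., U_n>, with the U_i listed in s; the order and the repetitions are
   irrelevant, and the box of the empty list is empty. *)
Definition vietoris_box (s : seq (set X)) : set hyperspace :=
  [set A : hyperspace | A `<=` \bigcup_(U in [set` s]) U /\
    forall U, U \in s -> A `&` U !=set0].

Definition vietoris_base : set (set hyperspace) :=
  [set W | exists s, (forall U, U \in s -> open U) /\ W = vietoris_box s].

Lemma vietoris_box1 (U : set X) :
  vietoris_box [:: U] = [set A : hyperspace | A `<=` U].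
Proof.
apply/seteqP; split => [A [AU _] x /AU[V /=]|A AU].
  by rewrite inE => /eqP->.
split; first by move=> x /AU Ux; exists U; rewrite //= inE.
move=> V; rewrite inE => /eqP->; have [x Ax] := hset_nonempty A.
by exists x; split=> //; exact: AU.
Qed.

Lemma vietoris_box2 (U : set X) :
  vietoris_box [:: U; setT] = [set A : hyperspace | A `&` U !=set0].
Proof.
apply/seteqP; split => [A [_ /(_ U)]|A AU]; first by rewrite inE eqxx; exact.
split; first by move=> x _; exists setT; rewrite //= !inE eqxx orbT.
move=> V; rewrite !inE => /orP[/eqP->//|/eqP->]; rewrite setIT.
exact: hset_nonempty.
Qed.

Lemma vietoris_base_cover : \bigcup_(W in vietoris_base) W = setT.
Proof.
apply/seteqP; split => // A _; exists (vietoris_box [:: setT]).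
  exists [:: setT]; split => // U; rewrite inE => /eqP->; exact: openT.
by rewrite vietoris_box1.
Qed.

Lemma vietoris_base_join (W1 W2 : set hyperspace) A :
  vietoris_base W1 -> vietoris_base W2 -> W1 A -> W2 A ->
  exists W, [/\ vietoris_base W, W A & W `<=` W1 `&` W2].
Proof.
move=> [s1 [s1o ->]] [s2 [s2o ->]] [As1 A1] [As2 A2].
pose S1 := \bigcup_(U in [set` s1]) U; pose S2 := \bigcup_(U in [set` s2]) U.
have oS1 : open S1 by exact: bigcup_open.
have oS2 : open S2 by exact: bigcup_open.
pose t1 := [seq U `&` S2 | U <- s1]; pose t2 := [seq S1 `&` U | U <- s2].
have in1 U : U \in s1 -> U `&` S2 \in t1 ++ t2.
  by move=> Us; rewrite mem_cat; apply/orP; left; apply/mapP; exists U.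
have in2 U : U \in s2 -> S1 `&` U \in t1 ++ t2.
  by move=> Us; rewrite mem_cat orbC; apply/orP; left; apply/mapP; exists U.
have tP V : V \in t1 ++ t2 -> (exists2 U, U \in s1 & V = U `&` S2) \/
    (exists2 U, U \in s2 & V = S1 `&` U).
  by rewrite mem_cat => /orP[] /mapP[U Us ->]; [left|right]; exists U.
exists (vietoris_box (t1 ++ t2)); split.
- exists (t1 ++ t2); split => // V /tP[[U Us ->]|[U Us ->]]; apply: openI => //.
  + exact: s1o.
  + exact: s2o.
- split.
    move=> x Ax; have [U Us Ux] := As1 x Ax.
    by exists (U `&` S2); [exact: in1|split => //; exact: As2].
  move=> V /tP[[U Us ->]|[U Us ->]].
    by have [x [Ax Ux]] := A1 U Us; exists x; split => //; split => //; exact: As2.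
  by have [x [Ax Ux]] := A2 U Us; exists x; split => //; split => //; exact: As1.
- move=> B [Bt Bh]; split; split.
  + move=> x /Bt[V /= /tP[[U Us ->]|[U Us ->]] [Vx Wx]]; last exact: Vx.
    by exists U.
  + by move=> U /in1/Bh[x [Bx [Ux _]]]; exists x.
  + move=> x /Bt[V /= /tP[[U Us ->]|[U Us ->]] [Vx Wx]]; first exact: Wx.
    by exists U.
  + by move=> U /in2/Bh[x [Bx [_ Ux]]]; exists x.
Qed.

HB.instance Definition _ := @isBaseTopological.Build hyperspace
  (set hyperspace) vietoris_base id vietoris_base_cover vietoris_base_join.

Lemma open_vietoris_base (W : set hyperspace) : vietoris_base W -> open W.
Proof.
by move=> WB; exists [set W]; [move=> _ ->|rewrite bigcup_set1].
Qed.

Lemma open_hyper_sub (U : set X) :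
  open U -> open [set A : hyperspace | A `<=` U].
Proof.
move=> oU; apply: open_vietoris_base; exists [:: U]; rewrite vietoris_box1.
by split => // V; rewrite inE => /eqP->.
Qed.

Lemma open_hyper_meet (U : set X) :
  open U -> open [set A : hyperspace | A `&` U !=set0].
Proof.
move=> oU; apply: open_vietoris_base; exists [:: U; setT].
rewrite vietoris_box2; split => // V.
by rewrite !inE => /orP[/eqP->//|/eqP->]; exact: openT.
Qed.

Lemma nbhs_hyper_sub (A : hyperspace) (U : set X) :
  open U -> A `<=` U -> nbhs A [set B : hyperspace | B `<=` U].
Proof. by move=> oU AU; apply: open_nbhs_nbhs; split => //; exact: open_hyper_sub. Qed.

Lemma nbhs_hyper_meet (A : hyperspace) (U : set X) :
  open U -> A `&` U !=set0 -> nbhs A [set B : hyperspace | B `&` U !=set0].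
Proof. by move=> oU AU; apply: open_nbhs_nbhs; split => //; exact: open_hyper_meet. Qed.

Lemma hyper_cvg (F : set_system hyperspace) (A : hyperspace) : Filter F ->
  (forall U, open U -> A `<=` U -> F [set B : hyperspace | B `<=` U]) ->
  (forall U, open U -> A `&` U !=set0 ->
    F [set B : hyperspace | B `&` U !=set0]) ->
  F --> A.
Proof.
move=> FF Fsub Fmeet W; rewrite nbhsE => -[B [[D' D'D DB]]] + BW.
rewrite -DB => -[V D'V VA]; have [s [so Vs]] := D'D _ D'V.
apply: (@filterS _ F _ V); first by move=> C VC; apply: BW; rewrite -DB; exists V.
move: VA; rewrite Vs => -[As Ah]; apply: filterI.
  by apply: Fsub => //; apply: bigcup_open.
suff : forall t : seq (set X), {subset t <= s} ->
    F [set C : hyperspace | forall U, U \in t -> C `&` U !=set0] by exact.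
elim=> [_|U t IH ts]; first by apply: filterS filterT => C _ U.
have FU : F [set C : hyperspace | C `&` U !=set0].
  by apply: Fmeet; [apply: so|apply: Ah]; apply: ts; rewrite inE eqxx.
have Ft := IH (fun V Vt => ts V (mem_behead (s := U :: t) Vt)).
apply: filterS2 FU Ft => C CU Ct U'; rewrite inE => /orP[/eqP->//|].
exact: Ct.
Qed.

Lemma hyper_continuous (T : topologicalType) (f : T -> hyperspace) :
  (forall U, open U -> open [set t | f t `<=` U]) ->
  (forall U, open U -> open [set t | f t `&` U !=set0]) -> continuous f.
Proof.
move=> fsub fmeet t; apply: (hyper_cvg (@fmap_filter _ _ f _ (nbhs_filter t))).
- by move=> U oU tU; apply: open_nbhs_nbhs; split => //; exact: fsub.
- by move=> U oU tU; apply: open_nbhs_nbhs; split => //; exact: fmeet.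
Qed.

End hyperspace.

Section hyperspace_compact.
Variable X : compact_hausdorff.

Lemma ch_closed_compact (A : set X) : closed A -> compact A.
Proof. by move=> cA; exact: subclosed_compact cA (@chspace_compact X) _. Qed.

Lemma ch_compact_closed (A : set X) : compact A -> closed A.
Proof. exact: compact_closed (@chspace_hausdorff X). Qed.

Lemma ch_separate (x : X) (A : set X) : closed A -> ~ A x ->
  exists U V : set X, [/\ open U, open V, U x, A `<=` V & U `&` V = set0].
Proof.
move=> cA nAx.
have reg := @compact_regular X x setT (@chspace_hausdorff X)
  (@chspace_compact X) (@filterT _ _ (nbhs_filter x)).
have [|N Nx cN] := reg (~` A).
  by apply: open_nbhs_nbhs; split => //; exact: closed_openC.
exists N°, (~` closure N); split.
- exact: open_interior.
- exact/closed_openC/closed_closure.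
- exact: Nx.
- by move=> y Ay /cN.
- apply/seteqP; split => // y [/interior_subset Ny]; apply.
  exact: subset_closure.
Qed.

Lemma hyper_hausdorff : hausdorff_space (hyperspace X).
Proof.
have sub (A B : hyperspace X) : cluster (nbhs A) B -> A `<=` B.
  move=> AB x Ax; apply: contrapT => nBx.
  have [U [V [oU oV Ux BV UV]]] := ch_separate (@hset_closed _ B) nBx.
  have AU : A `&` U !=set0 by exists x.
  have [C [[y [Cy Uy]] CV]] := AB _ _ (nbhs_hyper_meet oU AU) (nbhs_hyper_sub oV BV).
  have : (U `&` V) y by split => //; exact: CV.
  by rewrite UV.
move=> A B AB; apply: hyperP; apply/seteqP; split; first exact: sub.
apply: sub => P Q PB QA; have [C [QC PC]] := AB _ _ QA PB.
by exists C.
Qed.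

Lemma hyper_compact : compact [set: hyperspace X].
Proof.
rewrite compact_ultra => F UF _.
have FF : ProperFilter F by exact: ultra_proper.
pose L : set X := [set x | forall U, open U -> U x ->
  F [set B : hyperspace X | B `&` U !=set0]].
have cL : closed L.
  move=> x clx U oU Ux; have [|y [Ly Uy]] := clx U; first exact: open_nbhs_nbhs.
  exact: Ly.
have upL U : open U -> L `<=` U -> F [set B : hyperspace X | B `<=` U].
  move=> oU LU.
  have cCU : compact (~` U) by apply/ch_closed_compact/open_closedC.
  have cov : \forall B \near F, ~` U `<=` (fun x => ~ hset B x).
    move/compact_near_coveringP : cCU => /(_ _ F (fun B x => ~ hset B x) FF); apply => x nUx.
    have : ~ L x by move=> /LU.
    move=> /existsNP[V] /not_implyP[oV] /not_implyP[Vx nF].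
    have [//|FnV] := in_ultra_setVsetC [set B : hyperspace X | B `&` V !=set0] UF.
    exists (V, ~` [set B : hyperspace X | B `&` V !=set0]) => /=.
      by split => //; exact: open_nbhs_nbhs.
    by move=> [y B] /= [Vy nBV] By; apply: nBV; exists y.
  apply: filterS cov => B BU x Bx; apply: contrapT => nUx.
  exact: (BU x nUx Bx).
have L0 : L !=set0.
  apply: contrapT => nL.
  have [|B /=] := filter_ex (upL set0 open0 _).
    by move=> x Lx; apply: nL; exists x.
  by have [x Bx] := hset_nonempty B => /(_ x Bx).
exists (Hyperspace cL L0); split => //=.
apply: hyper_cvg => // U oU [x [Lx Ux]]; exact: Lx.
Qed.

Definition hyper_space : compact_hausdorff :=
  CompactHausdorff hyper_compact hyper_hausdorff.

End hyperspace_compact.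

Section hyperspace_operations.

Lemma hyper_map_closed (X Y : compact_hausdorff) (f : continuousType X Y)
  (A : hyperspace X) : closed (f @` A).
Proof.
apply: ch_compact_closed; apply: continuous_compact.
  exact/continuous_subspaceT/ctsP.
exact/ch_closed_compact/hset_closed.
Qed.

Lemma hyper_map_nonempty (X Y : compact_hausdorff) (f : continuousType X Y)
  (A : hyperspace X) : f @` A !=set0.
Proof. by have [x Ax] := hset_nonempty A; exists (f x), x. Qed.

Definition hyper_map (X Y : compact_hausdorff) (f : continuousType X Y)
    (A : hyperspace X) : hyperspace Y :=
  Hyperspace (@hyper_map_closed X Y f A) (@hyper_map_nonempty X Y f A).

Lemma hyper_single_closed (X : compact_hausdorff) (x : X) : closed [set x].
Proof. by apply: ch_compact_closed; exact: compact_set1. Qed.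

Lemma hyper_single_nonempty (X : compact_hausdorff) (x : X) : [set x] !=set0.
Proof. by exists x. Qed.

Definition hyper_single (X : compact_hausdorff) (x : X) : hyperspace X :=
  Hyperspace (@hyper_single_closed X x) (@hyper_single_nonempty X x).

Lemma hyper_union_closed (X : compact_hausdorff)
  (AA : hyperspace (hyper_space X)) : closed (\bigcup_(A in AA) (A : set X)).
Proof.
move=> x clx.
pose G := filter_from (nbhs x)
  (fun N => [set A : hyper_space X | hset AA A /\ A `&` N !=set0]).
have PG : ProperFilter G.
  apply: filter_from_proper; last first.
    by move=> N /clx[y [[A AAA Ay] Ny]]; exists A; split => //; exists y.
  apply: filter_from_filter; first by exists setT; exact: filterT.
  move=> M N xM xN; exists (M `&` N); first exact: filterI.
  by move=> A [AAA [y [Ay [My Ny]]]]; split; split => //; exists y.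
have cAA : compact AA by exact/ch_closed_compact/hset_closed.
have [|A [AAA clA]] := cAA G PG.
  by exists setT => [|A []//]; exact: filterT.
exists A => //; apply: contrapT => nAx.
have [U [V [oU oV Ux AV UV]]] := ch_separate (@hset_closed _ A) nAx.
have GU : G [set B : hyper_space X | hset AA B /\ B `&` U !=set0].
  by exists U => //; exact: open_nbhs_nbhs.
have [B [[_ [y [By Uy]]] BV]] := clA _ _ GU (nbhs_hyper_sub oV AV).
have : (U `&` V) y by split => //; exact: BV.
by rewrite UV.
Qed.

Lemma hyper_union_nonempty (X : compact_hausdorff)
  (AA : hyperspace (hyper_space X)) : \bigcup_(A in AA) (A : set X) !=set0.
Proof.
have [A AAA] := hset_nonempty AA; have [x Ax] := hset_nonempty A.
by exists x, A.
Qed.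

Definition hyper_union (X : compact_hausdorff)
    (AA : hyperspace (hyper_space X)) : hyperspace X :=
  Hyperspace (@hyper_union_closed X AA) (@hyper_union_nonempty X AA).

Lemma hyper_map_continuous (X Y : compact_hausdorff) (f : continuousType X Y) :
  continuous (hyper_map f).
Proof.
have /continuousP fo := @ctsP _ _ f.
apply: hyper_continuous => U /fo oU.
  suff <- : [set A : hyperspace X | A `<=` f @^-1` U] =
      [set A | hyper_map f A `<=` U] by exact: open_hyper_sub.
  apply/seteqP; split => A AU; first by move=> _ [x /AU Ux <-].
  by move=> x Ax; apply: AU; exists x.
suff <- : [set A : hyperspace X | A `&` f @^-1` U !=set0] =
    [set A | hyper_map f A `&` U !=set0] by exact: open_hyper_meet.
apply/seteqP; split => A.
  by move=> [x [Ax Ux]]; exists (f x); split => //; exists x.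
by move=> [_ [[x Ax <-] Ux]]; exists x.
Qed.

Lemma hyper_single_continuous (X : compact_hausdorff) :
  continuous (@hyper_single X).
Proof.
apply: hyper_continuous => U oU.
  suff <- : U = [set x | hyper_single x `<=` U] by [].
  by apply/seteqP; split => x; [move=> Ux _ ->|apply].
suff <- : U = [set x | hyper_single x `&` U !=set0] by [].
by apply/seteqP; split => x; [move=> Ux; exists x|move=> [_ [-> ]]].
Qed.

Lemma hyper_union_continuous (X : compact_hausdorff) :
  continuous (@hyper_union X).
Proof.
apply: hyper_continuous => U oU.
  suff <- : [set AA : hyperspace (hyper_space X) |
        AA `<=` [set A : hyperspace X | A `<=` U]] =
      [set AA | hyper_union AA `<=` U].
    exact/open_hyper_sub/open_hyper_sub.
  apply/seteqP; split => AA AAU; first by move=> x [A /AAU AU Ax]; exact: AU.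
  by move=> A AAA x Ax; apply: AAU; exists A.
suff <- : [set AA : hyperspace (hyper_space X) |
      AA `&` [set A : hyperspace X | A `&` U !=set0] !=set0] =
    [set AA | hyper_union AA `&` U !=set0].
  exact/open_hyper_meet/open_hyper_meet.
apply/seteqP; split => AA.
  by move=> [A [AAA [x [Ax Ux]]]]; exists x; split => //; exists A.
by move=> [x [[A AAA Ax] Ux]]; exists A; split => //; exists x.
Qed.

End hyperspace_operations.

Section hyperspace_monad.

Definition hyper_fmap (X Y : CompHaus) (f : hom X Y) :
    hom (hyper_space X : CompHaus) (hyper_space Y) :=
  mkcont (@hyper_map_continuous X Y f).

Lemma hyper_fmap1 (X : CompHaus) :
  hyper_fmap (idc X) = idc (hyper_space X : CompHaus).
Proof. by apply/continuousEP => A; apply: hyperP; exact: image_id. Qed.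

Lemma hyper_fmapM (X Y Z : CompHaus) (g : hom Y Z) (f : hom X Y) :
  hyper_fmap (g \oc f) = hyper_fmap g \oc hyper_fmap f.
Proof. by apply/continuousEP => A; apply: hyperP; rewrite /= -image_comp. Qed.

Definition hyper_functor : endofunctor CompHaus :=
  @Endofunctor CompHaus hyper_space hyper_fmap hyper_fmap1 hyper_fmapM.

Definition hyper_unit_component (X : CompHaus) : hom X (hyper_functor X) :=
  mkcont (@hyper_single_continuous X).

Lemma hyper_unit_natural (X Y : CompHaus) (f : hom X Y) :
  fmap hyper_functor f \oc hyper_unit_component X =
  hyper_unit_component Y \oc f.
Proof. by apply/continuousEP => x; apply: hyperP; exact: image_set1. Qed.

Definition hyper_unit : nattrans (fid CompHaus) hyper_functor :=
  @NatTrans CompHaus (fid CompHaus) hyper_functor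
    hyper_unit_component hyper_unit_natural.

Definition hyper_mult_component (X : CompHaus) :
    hom (hyper_functor (hyper_functor X)) (hyper_functor X) :=
  mkcont (@hyper_union_continuous X).

Lemma hyper_mult_natural (X Y : CompHaus) (f : hom X Y) :
  fmap hyper_functor f \oc hyper_mult_component X =
  hyper_mult_component Y \oc fmap (fcomp hyper_functor hyper_functor) f.
Proof.
apply/continuousEP => AA; apply: hyperP; apply/seteqP; split => /= y.
  move=> [x [A AAA Ax] <-]; exists (hyper_map f A); last by exists x.
  by exists A.
by move=> [_ [A AAA <-] [x Ax <-]]; exists x => //; exists A.
Qed.

Definition hyper_mult : nattrans (fcomp hyper_functor hyper_functor) hyper_functor :=
  @NatTrans CompHaus (fcomp hyper_functor hyper_functor) hyper_functor
    hyper_mult_component hyper_mult_natural.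

Lemma hyper_multA (X : CompHaus) :
  hyper_mult X \oc fmap hyper_functor (hyper_mult X) =
  hyper_mult X \oc hyper_mult (hyper_functor X).
Proof.
apply/continuousEP => AAA; apply: hyperP; apply/seteqP; split => /= x.
  by move=> [_ [AA AAAAA <-] [A AAA' Ax]]; exists A => //; exists AA.
by move=> [A [AA AAAAA AAA'] Ax]; exists (hyper_union AA); [exists AA|exists A].
Qed.

Lemma hyper_mult_unitl (X : CompHaus) :
  hyper_mult X \oc hyper_unit (hyper_functor X) = idc (hyper_functor X).
Proof. by apply/continuousEP => A; apply: hyperP; exact: bigcup_set1. Qed.

Lemma hyper_mult_unitr (X : CompHaus) :
  hyper_mult X \oc fmap hyper_functor (hyper_unit X) = idc (hyper_functor X).
Proof.
apply/continuousEP => A; apply: hyperP; apply/seteqP; split => /= x.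
  by move=> [_ [y Ay <-] ->].
by move=> Ax; exists (hyper_single x) => //; exists x.
Qed.

Definition hyperspace_monad : monad CompHaus :=
  @Monad CompHaus hyper_functor hyper_unit hyper_mult
    hyper_multA hyper_mult_unitl hyper_mult_unitr.

End hyperspace_monad.

(* Main.v *)
From mathcomp Require Import all_boot all_order all_algebra.
From mathcomp Require Import all_classical reals topology normedtype derive.
Require Import Defs.
Set Implicit Arguments.
Unset Strict Implicit.
Unset Printing Implicit Defensive.
Import Order.TTheory GRing.Theory Num.Theory.
Import numFieldNormedType.Exports.
Local Open Scope classical_set_scope.
Local Open Scope ring_scope.

(** A nonempty closed set [A] is sent to the functional [phi |-> max_A phi],
    the idempotent analogue of the uniform measure on [A].  The maximum exists
    because [A] is compact, and it commutes with adding constants and with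
    binary maxima, so it is an idempotent probability measure ([hyper_im]).

    All the identities required of a monad morphism are elementary facts about
    maxima: the maximum of [phi] over [f @` A] is that of [phi \o f] over [A],
    the maximum over a singleton is the value there, and the maximum over a
    union is the maximum of the maxima.  Each is proved by transporting a
    point at which the function is largest ([maximizer]) from one side of the
    identity to the other, where it again computes the maximum ([max_over_eq]).

    Continuity in [A] matches the two kinds of subbasic Vietoris open sets with
    the two halves of [|max_B phi - max_A phi| < e]: the upper bound says that
    [B] is contained in an open set, the lower bound that [B] meets one.

    Finally [A] can be recovered from its functional: if [x] lies in [A] but not
    in [B], a Urysohn function for [B] and [x] has maximum [0] over [B] and
    at least [1] over [A].  So the components are injective, hence
    monomorphisms. *)

Section max_over.
Variables (R : realType) (X : compact_hausdorff).
Implicit Types (phi psi : continuousType X R) (A B : hyperspace X).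

Definition max_over phi A : R := sup (phi @` A).

Lemma maximizer phi A :
  exists2 x, hset A x & forall y, hset A y -> phi y <= phi x.
Proof.
have cA : compact A by exact/ch_closed_compact/hset_closed.
have cphi : {within hset A, continuous phi} by exact/continuous_subspaceT/ctsP.
have [x /set_mem Ax phix] := compact_EVT_max (@hset_nonempty _ A) cA cphi.
by exists x => // y Ay; apply: phix; exact: mem_set.
Qed.

Lemma max_over_eq phi A x : hset A x ->
  (forall y, hset A y -> phi y <= phi x) -> max_over phi A = phi x.
Proof.
move=> Ax phix; have ub_phi : ubound (phi @` A) (phi x).
  by move=> _ [y Ay <-]; exact: phix.
apply/eqP; rewrite eq_le; apply/andP; split.
  by apply: ge_sup => //; exists (phi x), x.
by apply: ub_le_sup; [exists (phi x)|exists x].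
Qed.

Lemma max_over_attained phi A :
  exists2 x, hset A x & phi x = max_over phi A.
Proof.
by have [x Ax phix] := maximizer phi A; exists x => //; rewrite (max_over_eq Ax).
Qed.

Lemma max_over_ge phi A x : hset A x -> phi x <= max_over phi A.
Proof.
by have [y Ay phiy] := maximizer phi A; rewrite (max_over_eq Ay phiy); exact: phiy.
Qed.

Lemma max_over_const c A : max_over (cts_const X c) A = c.
Proof. by have [x Ax] := hset_nonempty A; rewrite (max_over_eq Ax). Qed.

Lemma max_over_odot c phi A :
  max_over (cts_odot c phi) A = c + max_over phi A.
Proof.
have [x Ax phix] := maximizer phi A.
rewrite (max_over_eq Ax phix) (max_over_eq Ax)//= => y Ay.
by rewrite lerD2l phix.
Qed.

Lemma max_over_oplus phi psi A :
  max_over (cts_oplus phi psi) A = Order.max (max_over phi A) (max_over psi A).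
Proof.
apply/eqP; rewrite eq_le; apply/andP; split.
  have [x Ax <-] := max_over_attained (cts_oplus phi psi) A.
  by rewrite /= ge_max !le_max !max_over_ge// orbT.
have [x Ax <-] := max_over_attained phi A.
have [y Ay <-] := max_over_attained psi A.
rewrite ge_max; apply/andP; split.
  by apply: le_trans (max_over_ge (cts_oplus phi psi) Ax); rewrite /= le_max lexx.
apply: le_trans (max_over_ge (cts_oplus phi psi) Ay).
by rewrite /= le_max lexx orbT.
Qed.

Definition hyper_im A : idempotent_measure R X :=
  @IdempotentMeasure R X (max_over ^~ A) (max_over_const ^~ A)
    (fun c phi => max_over_odot c phi A)
    (fun phi psi => max_over_oplus phi psi A).

(** Both halves of [|max_B phi - max_A phi| < e] are Vietoris neighbourhood
    conditions on [B]: it lies in the open set [phi < max_A phi + e], and it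
    meets the open set [phi > max_A phi - e]. *)
Lemma max_over_continuous phi :
  continuous (fun A : hyperspace X => max_over phi A).
Proof.
move=> A; apply/(@cvgrPdist_lt _ _ _ _ (nbhs_filter A)) => e e0.
set m := max_over phi A.
have below : nbhs A [set B : hyperspace X | B `<=` phi @^-1` `]-oo, m + e[].
  apply: nbhs_hyper_sub => [|x Ax /=].
    by apply: open_comp (interval_open _ _) => // x _; exact: ctsP.
  by rewrite in_itv/= (le_lt_trans (max_over_ge phi Ax))// ltrDl.
have above : nbhs A
    [set B : hyperspace X | B `&` phi @^-1` `]m - e, +oo[ !=set0].
  apply: nbhs_hyper_meet.
    by apply: open_comp (interval_open _ _) => // x _; exact: ctsP.
  have [x Ax phix] := max_over_attained phi A; exists x; split => //=.
  by rewrite in_itv/= andbT phix ltrBlDr ltrDl.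
apply: (@filterS2 _ _ (nbhs_filter A) _ _ _ _ below above).
move=> B /= Bbelow [x [Bx]]; rewrite /= in_itv/= andbT => phix.
rewrite ltr_distlC (lt_le_trans phix) ?max_over_ge//=.
have [y /Bbelow /= + <-] := max_over_attained phi B.
by rewrite in_itv.
Qed.

Lemma hyper_im_continuous : continuous hyper_im.
Proof. by apply: im_continuous => phi; exact: max_over_continuous. Qed.

End max_over.

Section injectivity.
Variables (R : realType) (X : compact_hausdorff).
Implicit Types A B : hyperspace X.

(** If [x] were in [A] but not in [B], a Urysohn function vanishing on [B] and
    equal to [1] at [x] would have a larger maximum over [A] than over [B]. *)
Lemma max_over_le_subset A B :
  (forall phi : continuousType X R, max_over phi A <= max_over phi B) ->
  A `<=` B.
Proof.
move=> leAB x Ax; apply: contrapT => nBx.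
have normX : normal_space X.
  exact: compact_normal (@chspace_hausdorff X) (@chspace_compact X).
have Bx0 : B `&` [set x] = set0.
  by apply/seteqP; split => // y [By yx]; apply: nBx; rewrite -yx.
have [f [cf _ fB fx]] := (@uniform_separatorP _ R _ _).1
  ((@normal_separatorP R X).1 normX _ _ (@hset_closed _ B)
    (@hyper_single_closed X x) Bx0).
have fxE : f x = 1 by apply: fx; exists x.
have [y By fy] := max_over_attained (mkcont cf) B.
have fyE : mkcont cf y = 0 by apply: fB; exists y.
have := le_trans (max_over_ge (mkcont cf) Ax) (leAB (mkcont cf)).
by rewrite -fy fyE /= /mkcts fxE ler10.
Qed.

Lemma hyper_im_inj : injective (@hyper_im R X).
Proof.
move=> A B AB; have maxAB phi : max_over phi A = max_over phi B :> R.
  by rewrite -[LHS]/(hyper_im R A phi) AB.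
apply: hyperP; apply/seteqP.
by split; apply: max_over_le_subset => phi; rewrite maxAB.
Qed.

End injectivity.

Section operations.
Variable R : realType.

Lemma hyper_im_map (X Y : compact_hausdorff) (f : continuousType X Y)
    (A : hyperspace X) :
  im_map f (hyper_im R A) = hyper_im R (hyper_map f A).
Proof.
apply: imP => phi; have [x Ax phix] := maximizer (cts_comp phi f) A.
rewrite /= (max_over_eq Ax phix) (@max_over_eq _ _ _ _ (f x))//; first by exists x.
by move=> _ [y Ay <-]; exact: phix.
Qed.

Lemma hyper_im_single (X : compact_hausdorff) (x : X) :
  hyper_im R (hyper_single x) = im_dirac R x.
Proof.
by apply: imP => phi; apply: max_over_eq => //= y ->.
Qed.

Definition hyper_im_cts (X : compact_hausdorff) :
    continuousType (hyper_space X) (im_space R X) :=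
  mkcont (@hyper_im_continuous R X).

(** The maximum over a union is the maximum of the maxima: if [A0] maximizes
    [max_A phi] among the members of the family and [x] maximizes [phi] over
    [A0], then [x] maximizes [phi] over the union. *)
Lemma hyper_im_union (X : compact_hausdorff)
    (AA : hyperspace (hyper_space X)) :
  hyper_im R (hyper_union AA) =
  im_flatten (hyper_im R (hyper_map (hyper_im_cts X) AA)).
Proof.
(* Naturality turns the maximum over the image family of measures into the
   maximum over [AA] of [A |-> max_A phi]. *)
apply: imP => phi; rewrite -hyper_im_map /=.
have [A0 AA0 maxA0] := maximizer (cts_comp (im_bar phi) (hyper_im_cts X)) AA.
rewrite (max_over_eq AA0 maxA0).
have [x A0x phix] := max_over_attained phi A0.
rewrite (@max_over_eq _ _ _ _ x) ?phix//; first by exists A0.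
move=> y [A AAA Ay]; exact: le_trans (max_over_ge phi Ay) (maxA0 A AAA).
Qed.

End operations.

Lemma injective_mono (X Y : compact_hausdorff) (f : continuousType X Y) :
  injective f -> @mono CompHaus X Y f.
Proof.
move=> f_inj Z g h /continuousEP fgh.
by apply/continuousEP => z; apply: f_inj; exact: fgh.
Qed.

Section hyper_to_im.
Variable R : realType.

Definition hyper_to_im_component (X : CompHaus) :
    hom (hyper_functor X) (im_functor R X) :=
  hyper_im_cts R X.

Lemma hyper_to_im_natural (X Y : CompHaus) (f : hom X Y) :
  fmap (im_functor R) f \oc hyper_to_im_component X =
  hyper_to_im_component Y \oc fmap hyper_functor f.
Proof. by apply/continuousEP => A; exact: hyper_im_map. Qed.

Definition hyper_to_im : nattrans hyper_functor (im_functor R) :=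
  @NatTrans CompHaus hyper_functor (im_functor R)
    hyper_to_im_component hyper_to_im_natural.

Lemma hyper_to_im_morphism :
  @monad_morphism CompHaus hyperspace_monad (idempotent_measure_monad R)
    hyper_to_im.
Proof.
split=> X; apply/continuousEP.
  by move=> x; exact: hyper_im_single.
by move=> AA; exact: hyper_im_union.
Qed.

End hyper_to_im.

Theorem theorem3p8 (R : realType) :
  submonad hyperspace_monad (idempotent_measure_monad R).
Proof.
exists (hyper_to_im R); split; first exact: hyper_to_im_morphism.
by move=> X; apply: injective_mono; exact: hyper_im_inj.
Qed.
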